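(* Let $G$ be a locally compact abelian group and let $A\subset G$ be a Borel measurable set with $\overline{\Delta}(A)>0$. Then there exists a finite subset $B\subset G$ such that $A-A+B=G$. Moreover, $B$ can be chosen with $\#B\le[1/\overline{\Delta}(A)]$, where $[\cdot]$ denotes the integer part.
   Context: Let $\mu$ be the Haar measure of the locally compact abelian group $G$ (written additively), and let $\mathcal{B}_0$ be the family of Borel subsets of $G$ with compact closure. For a Borel set $A\subset G$ define $$\overline{\Delta}(A):=\inf_{F\subset G,\ \#F<\infty}\ \sup_{V\in\mathcal{B}_0}\frac{\mu(A\cap V)}{\mu(F+V)}.$$ Conventions: $F\neq\emptyset$; a quotient $0/0$ is read as $0$. Here $A-A=\{a-a':a,a'\in A\}$ and $A-A+B=\{a-a'+b: a,a'\in A,\ b\in B\}$. *)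

(* Defs.v *)
From HB Require Import structures.
From mathcomp Require Import all_boot all_order all_algebra finmap.
From mathcomp Require Import all_classical all_reals all_analysis.

Set Implicit Arguments.
Unset Strict Implicit.
Unset Printing Implicit Defensive.

Import Order.TTheory GRing.Theory Num.Theory.

Local Open Scope classical_set_scope.
Local Open Scope ring_scope.

(* The library's [g_sigma_algebraType] asks for a pointed type, which a
   [topologicalZmodType] is not; this alias of G is pointed at 0. *)
Definition pointed_group (G : topologicalZmodType) : Type := G.
HB.instance Definition _ (G : topologicalZmodType) := Choice.on (pointed_group G).
HB.instance Definition _ (G : topologicalZmodType) :=
  isPointed.Build (pointed_group G) (0 : G).

(* G with its Borel sigma-algebra *)
Notation borel G := (g_sigma_algebraType (@open G : set (set (pointed_group G)))).

Definition borel_set (G : topologicalZmodType) (A : set G) : Prop :=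
  measurable (A : set (borel G)).

(* Radon convention: outer regular on all Borel sets, inner regular on open
   sets. *)
Record is_haar_measure (R : realType) (G : topologicalZmodType)
    (mu : {measure set (borel G) -> \bar R}) : Prop := {
  haar_invariant : forall (x : G) (A : set G), borel_set A ->
    mu [set x + a | a in A] = mu A ;
  haar_compact : forall K : set G, compact K -> (mu K < +oo)%E ;
  haar_neq0 : mu [set: G] != 0%E ;
  haar_outer : forall A : set G, borel_set A ->
    mu A = ereal_inf [set mu U | U in [set U : set G | open U /\ A `<=` U]] ;
  haar_inner : forall U : set G, open U ->
    mu U = ereal_sup [set mu K | K in [set K : set G | compact K /\ K `<=` U]]
}.

Definition sumset (G : zmodType) (A B : set G) : set G :=
  [set a + b | a in A & b in B].

Definition diffset (G : zmodType) (A B : set G) : set G :=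
  [set a - b | a in A & b in B].

(* Borel sets with compact closure *)
Definition borel_relcompact (G : topologicalZmodType) : set (set G) :=
  [set V | borel_set V /\ compact (closure V)].

(* In [\bar R], [0^-1 = +oo] and [0 * +oo = 0], so that [0 / 0 = 0]. For F
   nonempty and V relatively compact the quotient below is never of the form
   c / 0 with c > 0, nor does it involve +oo. *)
Definition upper_density (R : realType) (G : topologicalZmodType)
    (mu : {measure set (borel G) -> \bar R}) (A : set G) : \bar R :=
  ereal_inf [set
    ereal_sup [set (mu (A `&` V) / mu (sumset [set` F] V))%E
              | V in @borel_relcompact G]
  | F in [set F : {fset G} | F != fset0]].

(* Main.v *)
Require Import Defs.
From mathcomp Require Import all_boot all_order all_algebra finmap.
From mathcomp Require Import all_classical all_reals all_analysis.

Import Order.TTheory GRing.Theory Num.Theory.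

Local Open Scope classical_set_scope.
Local Open Scope ring_scope.

(** If the translates [b + A], [b] in a finite set [B], are pairwise disjoint,
    then for every [V] the set [B + V] contains the [#B] disjoint translates
    [b + (A `&` V)], so [#B * mu (A `&` V) <= mu (B + V)]; taking [F = B] in the
    definition of the density gives [#B * upper_density mu A <= 1]. Hence there
    is such a [B] of maximal cardinality, and for every [g] maximality makes
    [g + A] meet some [b + A], that is, [g] lies in [A - A + b]. *)

Lemma translation_continuous (G : topologicalZmodType) (x : G) :
  continuous (fun a : G => x + a).
Proof.
move=> a; have := @add_continuous G (x, a).
by move=> add_cvg; exact: (cvg_comp2 (cvg_cst x) cvg_id add_cvg).
Qed.

(** Writing a translate as a preimage lets Borel measurability be pulled back along a continuous
    map. *)
Lemma translate_preimage (G : zmodType) (x : G) (A : set G) :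
  [set x + a | a in A] = (fun a => - x + a) @^-1` A.
Proof.
apply/seteqP; split=> [_ [a Aa <-]|a Aa] /=; first by rewrite addKr.
by exists (- x + a) => //; rewrite addNKr.
Qed.

Lemma translate_borel (G : topologicalZmodType) (x : G) (A : set G) :
  borel_set A -> borel_set [set x + a | a in A].
Proof.
move=> mA; rewrite translate_preimage /borel_set.
have mf : measurable_fun setT (fun a : borel G => (- x + a : borel G)).
  (* It suffices to test the generating open sets, whose preimages are open by continuity. *)
  apply: measurability; first by [].
  move=> _ [U oU <-]; rewrite setTI; apply: sub_sigma_algebra.
  by move/continuousP: (@translation_continuous G (- x)); exact.
by rewrite -[X in measurable X]setTI; exact: mf.
Qed.

Lemma sumset_bigcup (G : zmodType) (A B : set G) :
  sumset A B = \bigcup_(a in A) [set a + b | b in B].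
Proof.
apply/seteqP; split=> x.
  by case=> a Aa [b Bb <-]; exists a => //; exists b.
by case=> a Aa [b Bb <-]; exists a => //; exists b.
Qed.

Lemma measure_sumset_ge (R : realType) (G : topologicalZmodType)
    (mu : {measure set (borel G) -> \bar R}) (mu_haar : is_haar_measure mu)
    (A V : set G) (B : {fset G}) :
  borel_set A -> borel_set V ->
  trivIset [set` B] (fun b => [set b + a | a in A]) ->
  (((#|` B|)%fset%:R)%:E * mu (A `&` V) <= mu (sumset [set` B] V))%E.
Proof.
move=> mA mV AB.
have mAV : borel_set (A `&` V) by exact: measurableI.
(* These translates inherit disjointness from the larger sets [b + A]. *)
have ABV : trivIset [set` B] (fun b => [set b + a | a in A `&` V]).
  move=> i j Bi Bj [_ [[a [Aa _] <-] [a' [Aa' _] aa']]]; apply: AB => //.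
  by exists (i + a); split; [exists a | exists a'].
have -> : (((#|` B|)%fset%:R)%:E * mu (A `&` V) =
           mu (\bigcup_(b in [set` B]) [set (b + a)%R | a in A `&` V]))%E.
  rewrite bigcup_fset measure_fbigsetU//; last first.
    by move=> b _; exact: translate_borel.
  rewrite (eq_bigr (fun=> mu (A `&` V))); last first.
    by move=> b _; exact: haar_invariant.
  by rewrite big_const_seq count_predT -Monoid.iteropE mule_natl.
(* Monotonicity requires both sides to be Borel; [B + V] is, being a finite union of translates of
   [V]. *)
rewrite sumset_bigcup; apply: le_measure; rewrite ?inE.
- apply: fin_bigcup_measurable => [|b _]; first exact: finite_fset.
  exact: translate_borel.
- apply: fin_bigcup_measurable => [|b _]; first exact: finite_fset.
  exact: translate_borel.
- by apply: subset_bigcup => b _ _ [a [_ Va] <-]; exists a.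
Qed.

Lemma lee_div_natV (R : realType) (x y : \bar R) (n : nat) :
  (0 < n)%N -> (0 <= x)%E -> (n%:R%:E * x <= y)%E ->
  (x / y <= (n%:R^-1)%:E)%E.
Proof.
move=> n0; have nR : 0 < n%:R :> R by rewrite ltr0n.
have nV : 0 <= n%:R^-1 :> R by rewrite invr_ge0 ltW.
case: y => [r||]; last 2 first.
- by rewrite invey mule0 lee_fin.
- move=> x0; rewrite leeNy_eq => /eqP xN.
  by have := mule_ge0 (ltW (_ : 0%:E < n%:R%:E)%E) x0; rewrite xN lte_fin => /(_ nR).
case: x => [s||]; last 2 first.
- by move=> _; rewrite mulry gtr0_sg// mul1e.
- by [].
(* A zero denominator forces [s = 0], and the quotient is then [0 * +oo = 0]: the convention for
   [0 / 0] is what saves the bound. *)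
rewrite !lee_fin => s0 sr; rewrite inver; case: eqP => [r0|/eqP r0].
  move: sr; rewrite r0 pmulr_rle0// => s0'.
  by rewrite (@le_anti _ _ s 0) ?s0 ?s0'// mul0e lee_fin.
have rp : 0 < r by rewrite lt_neqAle eq_sym r0 (le_trans _ sr)// mulr_ge0// ltW.
by rewrite lee_fin ler_pdivrMr// ler_pdivlMl.
Qed.

Lemma upper_density_le (R : realType) (G : topologicalZmodType)
    (mu : {measure set (borel G) -> \bar R}) (mu_haar : is_haar_measure mu)
    (A : set G) (B : {fset G}) :
  borel_set A -> B != fset0 ->
  trivIset [set` B] (fun b => [set b + a | a in A]) ->
  (upper_density mu A <= (((#|` B|)%fset%:R)^-1)%:E)%E.
Proof.
move=> mA B0 AB; apply: ge_ereal_inf; eexists; first by exists B.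
apply: ge_ereal_sup => _ [V [mV _] <-].
apply: lee_div_natV; [by rewrite cardfs_gt0 | exact: measure_ge0 |].
exact: measure_sumset_ge.
Qed.

Lemma maximal_disjoint_translates_cover (G : zmodType) (A : set G)
    (B : {fset G}) :
  A !=set0 ->
  trivIset [set` B] (fun b => [set b + a | a in A]) ->
  (forall C : {fset G}, trivIset [set` C] (fun b => [set b + a | a in A]) ->
     (#|` C| <= #|` B|)%fset%N) ->
  sumset (diffset A A) [set` B] = setT.
Proof.
move=> [a0 Aa0] AB maxB; apply/seteqP; split=> // g _.
(* If [g] is already in [B], adjoining it does not enlarge [B], so maximality says nothing; instead
   [g = (a0 - a0) + g]. *)
have [Bg|nBg] := boolP (g \in B).
  exists 0; first by exists a0 => //; exists a0 => //; rewrite subrr.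
  by exists g; rewrite ?add0r.
have [[b Bb [_ [[a Aa <-] [a' Aa' aa']]]]|nAB] :=
  pselect (exists2 b, b \in B &
    [set g + a | a in A] `&` [set b + a | a in A] !=set0).
  (* A common point [g + a = b + a'] gives [g = (a' - a) + b]. *)
  exists (a' - a); first by exists a' => //; exists a.
  by exists b => //; rewrite addrAC [a' + b]addrC aa' addrK.
have /maxB : trivIset [set` (g |` B)%fset] (fun b => [set b + a | a in A]).
  move=> i j /= /fset1UP[->|Bi] /fset1UP[->|Bj] ij //.
  - by case: nAB; exists j.
  - by case: nAB; exists i; rewrite // setIC.
  - exact: AB ij.
by rewrite cardfsU1 nBg ltnn.
Qed.

Theorem theorem2 (R : realType) (G : topologicalZmodType)
    (G_hausdorff : hausdorff_space G)
    (G_locally_compact : locally_compact [set: G])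
    (mu : {measure set (borel G) -> \bar R}) (mu_haar : is_haar_measure mu)
    (A : set G) (A_borel : borel_set A)
    (A_dense : (0 < upper_density mu A)%E) :
  exists B : {fset G},
    sumset (diffset A A) [set` B] = [set: G] /\
    ((#|` B|)%fset%:Z <= Num.floor (fine (upper_density mu A))^-1)%R.
Proof.
pose sep (B : {fset G}) := trivIset [set` B] (fun b => [set b + a | a in A]).
have sep1 : sep [fset 0]%fset by move=> i j /= /fset1P-> /fset1P->.
have density_le (B : {fset G}) : B != fset0 -> sep B ->
    (upper_density mu A <= (((#|` B|)%fset%:R)^-1)%:E)%E.
  by move=> B0 sB; exact: upper_density_le.
(* The one-element family [{0}] bounds the density by 1, so [fine] loses nothing. *)
have d_fin : upper_density mu A \is a fin_num.
  rewrite ge0_fin_numE ?ltW// (le_lt_trans (density_le _ _ sep1)) ?ltry//.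
  by rewrite -cardfs_gt0 cardfs1.
have [d dE] : exists d : R, upper_density mu A = d%:E.
  by exists (fine (upper_density mu A)); rewrite fineK.
rewrite dE /= in A_dense density_le *; rewrite lte_fin in A_dense.
have card_le (B : {fset G}) : sep B -> (#|` B|)%fset%:R <= d^-1.
  (* The empty family is not an admissible [F] in the density, so it is treated apart. *)
  have [->|B0] := eqVneq B fset0; first by rewrite cardfs0 invr_ge0 ltW.
  move=> /(density_le _ B0); rewrite lee_fin => dB.
  by rewrite -[leLHS]invrK lef_pV2// posrE invr_gt0 ltr0n cardfs_gt0.
(* For empty [A] every quotient with [F = {0}] is 0, contradicting positive density. *)
have A0 : A !=set0.
  apply/set0P/eqP => A0.
  suff : (upper_density mu A <= 0)%E by rewrite dE lee_fin leNgt A_dense.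
  apply: ge_ereal_inf; eexists.
    by exists [fset 0]%fset => //=; rewrite -cardfs_gt0 cardfs1.
  by apply: ge_ereal_sup => _ [V _ <-]; rewrite A0 set0I measure0 mul0e.
(* Maximality is sought among the cardinalities, a nonempty set of naturals bounded by the integer
   part of [d^-1]. *)
pose size_of n := `[< exists2 B, sep B & #|` B|%fset = n >].
have ex_size : exists n, size_of n.
  by exists (#|` [fset 0 : G]|)%fset; apply/asboolP; exists [fset 0]%fset.
have bounded n : size_of n -> (n <= Num.truncn d^-1)%N.
  by move/asboolP=> [B sB <-]; rewrite truncn_ge_nat ?card_le// invr_ge0 ltW.
case: (ex_maxnP ex_size bounded) => _ /asboolP[B sB <-] maxB.
exists B; split.
  apply: maximal_disjoint_translates_cover => // C sC.
  by apply: maxB; apply/asboolP; exists C.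
by rewrite floor_ge_int card_le.
Qed.
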